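(* Let $R$ be a $d\times d$ expansive integer matrix, $S=R^T$, and let $B$ and $L$ be finite subsets of $\mathbb{R}^d$ such that $(R,B,L)$ is a Hadamard triple. Let $X_L$ be the attractor of the iterated function system $\tau_l(x)=S^{-1}(x+l)$, $l\in L$. Suppose there exist $d$ linearly independent vectors in the lattice $\Gamma$ generated by $$\Big\{\sum_{k=0}^nR^kb_k \;\Big|\; b_k\in B,\ n\in\mathbb{N}\Big\}.$$ Define $$\Gamma^\circ:=\{x\in\mathbb{R}^d\mid \beta\cdot x\in\mathbb{Z}\text{ for all }\beta\in\Gamma\}.$$ Then $\Gamma^\circ$ is a lattice that contains $\mathbb{Z}^d$, is invariant under $S$ (that is, $S\Gamma^\circ\subset\Gamma^\circ$), and if $l,l'\in L$ with $l-l'\in S\Gamma^\circ$ then $l=l'$. Moreover, $$\Gamma^\circ\cap X_L=\bigcup\{C\mid C\text{ is a }W_B\text{-cycle}\}.$$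
   Context: A matrix is expansive if all its eigenvalues $\lambda$ satisfy $|\lambda|>1$. $R^T$ is the transpose of $R$, and $\mathbb{N}=\{0,1,2,\dots\}$. $(R,B,L)$ is a Hadamard triple if $L$ has the same cardinality $N$ as $B$ and the matrix $\frac{1}{\sqrt N}(e^{2\pi i R^{-1}b\cdot l})_{b\in B,\,l\in L}$ is unitary. The attractor $X_L$ is the unique nonempty compact set with $X_L=\bigcup_{l\in L}\tau_l(X_L)$. Put $m_B(x)=\frac1N\sum_{b\in B}e^{2\pi i b\cdot x}$ and $W_B=|m_B|^2$ on $\mathbb{R}^d$. A cycle for the system $(\tau_l)_{l\in L}$ is a finite set $C=\{x_0,\ x_1=\tau_{l_1}x_0,\ \dots,\ x_{p-1}=\tau_{l_{p-1}}\cdots\tau_{l_1}x_0\}\subset\mathbb{R}^d$ with $p\ge1$ and $l_1,\dots,l_p\in L$ such that $\tau_{l_p}\cdots\tau_{l_1}x_0=x_0$. A $W_B$-cycle is a cycle $C$ such that $W_B(x)=1$ for all $x\in C$. The lattice $\Gamma$ generated by a set means the additive subgroup of $\mathbb{R}^d$ generated by it; that $\Gamma^\circ$ is a lattice means that it is a discrete additive subgroup spanning $\mathbb{R}^d$.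
   Formalization: The formal theorem additionally assumes that B is contained in Z^d, that 0 belongs to B, and that R^n b·l is an integer for all n in N, b in B, l in L; without any one of these the claim fails already for d = 1. *)

(* Defs.v *)
From HB Require Import structures.
From mathcomp Require Import all_boot all_order all_algebra.
From mathcomp Require Import finmap complex.
From mathcomp Require Import all_classical all_reals all_analysis.
Set Implicit Arguments.
Unset Strict Implicit.
Unset Printing Implicit Defensive.
Import Order.TTheory GRing.Theory Num.Theory.
Import numFieldNormedType.Exports.
Local Open Scope classical_set_scope.
Local Open Scope ring_scope.
Local Open Scope complex_scope.

Section Defs.
Context {K : realType} {d : nat}.
Local Notation V := 'cV[K]_d.
Implicit Types (M : 'M[K]_d) (B L : {fset V}) (x y : V) (C G X : set V).

Definition dotp x y : K := \sum_(i < d) x i 0 * y i 0.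

Definition integer_vectors : set V := [set x | forall i, x i 0 \is a Num.int].

(* The eigenvalues are the complex ones. *)
Definition expansive M : Prop :=
  forall a : K[i], eigenvalue (map_mx (real_complex K) M) a -> 1 < `|a|.

(* t |-> e^(2 pi i t) *)
Definition expi2pi (t : K) : K[i] :=
  cos (2 * pi * t) +i* sin (2 * pi * t).

(* B and L are enumerated in an arbitrary order, on which unitarity does not
   depend; the equality of cardinals makes both enumerations full. *)
Definition hadamard_triple M B L : Prop :=
  #|` L| = #|` B| /\
  \matrix_(i < #|` B|, j < #|` B|)
     ((Num.sqrt (#|` B|%:R : K))^-1%:C *
      expi2pi (dotp (invmx M *m B`_i) L`_j)) \is unitarymx.

(* tau_l(x) = S^-1 (x + l) *)
Definition tau M (l x : V) : V := invmx M *m (x + l).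

(* For S expansive and L nonempty the attractor exists and is unique, so that
   "is_attractor S L X" says that X is the attractor. *)
Definition is_attractor M L X : Prop :=
  [/\ X !=set0, compact X & X = \bigcup_(l in [set` L]) tau M l @` X].

Definition additive_subgroup G : Prop :=
  G 0 /\ forall x y, G x -> G y -> G (x - y).

(* The subgroup generated by the sums \sum_(k <= n) M^k b_k. *)
Definition Gamma M B : set V :=
  smallest additive_subgroup
    [set x | exists n (b : nat -> V), (forall k, (k <= n)%N -> b k \in B) /\
             x = \sum_(k < n.+1) (M ^+ k) *m b k].

Definition dual_group G : set V :=
  [set x | forall g, G g -> dotp g x \is a Num.int].

Definition is_lattice G : Prop :=
  [/\ additive_subgroup G,
      G `<=` isolated G
    & exists s : seq V, (forall x, x \in s -> G x) /\ span s = fullv].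

Definition m_B B x : K[i] :=
  (#|` B|%:R)^-1 * \sum_(b <- B) expi2pi (dotp b x).

Definition W_B B x : K[i] := `|m_B B x| ^+ 2.

(* The points x_0, ..., x_(p-1) need not be distinct. *)
Definition is_cycle M L C : Prop :=
  exists p (l x : nat -> V),
    [/\ (0 < p)%N,
        forall k, (k < p)%N -> l k \in L /\ x k.+1 = tau M (l k) (x k),
        x p = x 0%N
      & C = [set x k | k in `I_p]].

Definition is_WB_cycle M B L C : Prop :=
  is_cycle M L C /\ forall x, C x -> W_B B x = 1.

End Defs.

(* Main.v *)
Require Import Defs.
From mathcomp Require Import all_boot all_order all_algebra.
From mathcomp Require Import finmap complex.
From mathcomp Require Import all_classical all_reals all_analysis.
From mathcomp Require Import ring lra.
Import Order.TTheory GRing.Theory Num.Theory.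
Import numFieldNormedType.Exports.
Local Open Scope classical_set_scope.
Local Open Scope ring_scope.

(** Write G for the dual group of Gamma.  As 0 is a digit of B, Gamma is
    generated by the vectors R^n b, so that x lies in G exactly when every
    R^n b . x is an integer ([dual_GammaP]).  This makes G an additive group
    containing the integer vectors and the digits of L, and stable under
    S = R^T.  Pairing with d independent elements of Gamma embeds G linearly
    into an integer grid, whence discreteness ([dual_group_separated]).

    Two digits of L that are congruent modulo SG give the same column of the
    Hadamard matrix, because b . x is an integer for x in G; columns of a
    unitary matrix are pairwise distinct ([hadamard_digit_unique]).

    A point of G in the attractor X_L has a predecessor y = S x - l in X_L
    under some tau_l, and y is in G again.  Uniqueness of digits modulo SG says
    that a point of G has at most one successor in G, hence passing to the
    predecessor is injective.  An injective self-map of a subset of a compact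
    set that has no accumulation point has only periodic points
    ([injective_orbit_periodic]), so every point of G in X_L lies on a cycle;
    and W_B = 1 on G ([dual_attractor_cycle]).

    Conversely, W_B x = 1 forces b . x to be an integer for all b in B: an
    average of unimodular numbers, one of which is 1, has modulus 1 only if all
    of them are 1 ([W_B_eq1P]).  Along a cycle the relation S x' = x + l
    propagates this integrality to all R^n b . x, so that the cycle lies in G
    ([WB_cycle_sub_dual]).  It lies in X_L because running around it from any
    point y of X_L produces the points x + S^-(pn) (y - x) of the closed set
    X_L, and these tend to x ([attractor_cycle]).  That S^-n tends to 0 is read
    off the factorization of the characteristic polynomial of R^-1 over the
    complex numbers ([spectral_contraction_powers]). *)

(** * The inner product *)

Section InnerProduct.
Context {K : realType} {d : nat}.
Implicit Types (x y z : 'cV[K]_d) (M : 'M[K]_d).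

Lemma dotpE x y : dotp x y = (x^T *m y) 0 0.
Proof. by rewrite mxE; apply: eq_bigr => i _; rewrite mxE. Qed.

Lemma dotpDl x y z : dotp (x + y) z = dotp x z + dotp y z.
Proof. by rewrite !dotpE linearD mulmxDl mxE. Qed.

Lemma dotpDr x y z : dotp x (y + z) = dotp x y + dotp x z.
Proof. by rewrite !dotpE mulmxDr mxE. Qed.

Lemma dotpNl x y : dotp (- x) y = - dotp x y.
Proof. by rewrite !dotpE linearN mulNmx mxE. Qed.

Lemma dotpNr x y : dotp x (- y) = - dotp x y.
Proof. by rewrite !dotpE mulmxN mxE. Qed.

Lemma dotp0l x : dotp 0 x = 0.
Proof. by rewrite dotpE trmx0 mul0mx mxE. Qed.

Lemma dotp0r x : dotp x 0 = 0.
Proof. by rewrite dotpE mulmx0 mxE. Qed.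

Lemma dotpZl (a : K) x y : dotp (a *: x) y = a * dotp x y.
Proof. by rewrite !dotpE linearZ -scalemxAl mxE. Qed.

Lemma dotp_suml (I : Type) (r : seq I) (P : pred I) (F : I -> 'cV[K]_d) y :
  dotp (\sum_(i <- r | P i) F i) y = \sum_(i <- r | P i) dotp (F i) y.
Proof.
elim/big_rec2: _ => [|i a b _ <-]; first exact: dotp0l.
by rewrite dotpDl.
Qed.

Lemma dotp_adjoint M x y : dotp (M *m x) y = dotp x (M^T *m y).
Proof. by rewrite !dotpE trmx_mul mulmxA. Qed.

Lemma dotp_delta i x : dotp (delta_mx i 0) x = x i 0.
Proof.
rewrite /dotp (bigD1 i)//= big1 => [|j ji]; rewrite mxE ?eqxx ?mul1r ?addr0//.
by rewrite (negbTE ji) mul0r.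
Qed.

Lemma dotp_continuous x : continuous (dotp x : 'cV[K]_d -> K).
Proof.
apply: continuous_big => [|i _]; first exact: add_continuous.
move=> y; apply: cvgMl_tmp; first exact: (nbhs_filter y).
exact: (@coord_continuous K d 1 i 0 y).
Qed.

End InnerProduct.

(** * The character t |-> e^(2 pi i t) *)

Section Character.
Context {K : realType}.
Implicit Types s t : K.

Lemma expi2pi0 : expi2pi 0 = 1 :> K[i]%C.
Proof. by rewrite /expi2pi mulr0 cos0 sin0. Qed.

Lemma expi2piD s t : expi2pi (s + t) = expi2pi s * expi2pi t.
Proof.
rewrite /expi2pi mulrDr cosD sinD /GRing.mul /=; apply/eqP.
by rewrite eq_complex /= eqxx/= [X in X == _]addrC.
Qed.

Lemma conj_expi2pi t : (expi2pi t)^* = expi2pi (- t).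
Proof. by rewrite /expi2pi mulrN cosN sinN. Qed.

Lemma norm_expi2pi t : `|expi2pi t| = 1.
Proof. by rewrite normc_def /= cos2Dsin2 sqrtr1. Qed.

Lemma expi2pi_int t : t \is a Num.int -> expi2pi t = 1.
Proof.
have e1 : expi2pi 1 = 1 :> K[i]%C.
  by rewrite /expi2pi mulr1 mulr_natl cos2pi sin2pi.
have en n : expi2pi (n%:R : K) = 1.
  by elim: n => [|n IHn]; rewrite ?expi2pi0// -natr1 expi2piD IHn e1 mulr1.
move=> /intrP[[n|n] ->]; first exact: en.
by rewrite NegzE mulrNz -conj_expi2pi en rmorph1.
Qed.

(** Subtracting the floor of t reduces to the interval [0, 1), and the symmetry
    f |-> 1 - f to [0, 1/2], where f |-> cos (2 pi f) is injective. *)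
Lemma expi2pi_eq1 t : expi2pi t = 1 -> t \is a Num.int.
Proof.
move=> et; pose f := t - (Num.floor t)%:~R.
have ef : cos (2 * pi * f) = 1.
  have : expi2pi f = 1.
    by rewrite expi2piD et mul1r -mulrNz expi2pi_int// intr_int.
  by rewrite /expi2pi => -[].
have /andP[f0 f1] : 0 <= f < 1.
  have := floorD1_gt t; rewrite intrD => ft.
  by rewrite subr_ge0 floor_le ltrBlDl.
have p0 := pi_gt0 K.
have cos_half_period (x : K) : 0 <= x <= 1 / 2 -> cos (2 * pi * x) = 1 -> x = 0.
  move=> /andP[x0 x1] cx.
  have /eqP : 2 * pi * x = 0.
    apply: cos_inj; rewrite ?cos0// in_itv/= ?lexx ?(ltW p0)//.
    have := mulr_ge0 (ltW p0) x0.
    have : 0 <= pi * (1 / 2 - x) by rewrite mulr_ge0 ?(ltW p0)// subr_ge0.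
    by move=> *; apply/andP; split; lra.
  by rewrite !mulf_eq0 pnatr_eq0 (gt_eqF p0)/= => /eqP.
have [fh|fh] := leP f (1 / 2).
  have : f = 0 by apply: cos_half_period => //; rewrite f0.
  by move/eqP; rewrite subr_eq0 => /eqP ->; rewrite intr_int.
suff : 1 - f = 0 by lra.
apply: cos_half_period; first by lra.
have -> : 2 * pi * (1 - f) = - (2 * pi * f) + pi *+ 2 by ring.
by rewrite cosD cos2pi sin2pi mulr0 subr0 mulr1 cosN.
Qed.

End Character.

(** * The weight W_B *)

Section Weight.
Context {K : realType} {d : nat}.
Implicit Types (x : 'cV[K]_d) (B : {fset 'cV[K]_d}).

(** The term b = 0 of the average m_B is 1, so the equality case of the triangle
    inequality forces all the terms to be 1. *)
Lemma W_B_eq1P B x : 0 \in B ->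
  W_B B x = 1 <-> forall b, b \in B -> dotp b x \is a Num.int.
Proof.
move=> B0; pose N := #|` B|; pose F (i : 'I_N) := expi2pi (dotp B`_i x).
have N0 : (N%:R : K[i]%C) != 0.
  by rewrite pnatr_eq0 cardfs_eq0; apply/fset0Pn; exists 0.
have mE : m_B B x = N%:R^-1 * \sum_i F i.
  by rewrite /m_B (big_nth 0) big_mkord.
split=> [W1 b bB|Bint].
  have /eqP sumE : `|\sum_i F i| == \sum_i `|F i|.
    have : `|m_B B x| == 1.
      by rewrite -(@eqrXn2 _ 2%N)// expr1n; apply/eqP.
    rewrite mE normrM normfV normr_nat (can2_eq (mulVKf N0) (mulKf N0)) mulr1.
    move=> /eqP ->; under eq_bigr do rewrite norm_expi2pi.
    by rewrite sumr_const card_ord.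
  have [t _ Ft] := normC_sum_eq1 sumE (fun i _ => norm_expi2pi _).
  have Fnth c (cB : c \in B) : expi2pi (dotp c x) = t.
    have ltc : (index c B < N)%N by rewrite index_mem.
    by rewrite -(Ft (Ordinal ltc) isT) /F /= nth_index.
  by apply: expi2pi_eq1; rewrite Fnth// -(Fnth 0 B0) dotp0l expi2pi0.
rewrite /W_B mE (eq_bigr (fun=> 1)) => [|i _].
  by rewrite sumr_const card_ord mulVf// normr1 expr1n.
by apply/expi2pi_int/Bint; rewrite mem_nth.
Qed.

End Weight.

(** * The dual group of Gamma *)

Section Dual.
Context {K : realType} {d : nat}.
Implicit Types (x y : 'cV[K]_d) (R : 'M[K]_d) (B L : {fset 'cV[K]_d}).

Lemma dual_group_additive (G : set 'cV[K]_d) : additive_subgroup (dual_group G).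
Proof.
split=> [g _|x y xG yG g Gg]; first by rewrite dotp0r.
by rewrite dotpDr dotpNr rpredB ?xG ?yG.
Qed.

(** The digit 0 allows all but one term of a generator of Gamma to vanish. *)
Lemma dual_GammaP R B x : 0 \in B ->
  dual_group (Gamma R B) x <->
  forall n b, b \in B -> dotp (R ^+ n *m b) x \is a Num.int.
Proof.
move=> B0; split=> [xG n b bB|xB].
  apply: xG; apply: sub_gen_smallest.
  exists n, (fun k => if k == n then b else 0); split=> [k _|].
    by case: ifP.
  rewrite (bigD1 ord_max)//= eqxx big1 ?addr0// => i.
  by rewrite -val_eqE /= => /negbTE ->; rewrite mulmx0.
suff : Gamma R B `<=` [set g | dotp g x \is a Num.int] by move=> GB g /GB.
apply: smallest_sub => [|_ [n [b [bB ->]]]] /=.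
  split=> [|g h /= gx hx] /=; first by rewrite dotp0l.
  by rewrite dotpDl dotpNl rpredB.
by rewrite dotp_suml rpred_sum// => i _; rewrite xB// bB// -ltnS.
Qed.

Lemma dual_Gamma_trmx R B x : 0 \in B ->
  dual_group (Gamma R B) x -> dual_group (Gamma R B) (R^T *m x).
Proof.
move=> B0 /(dual_GammaP _ _ _ B0) xG; apply/dual_GammaP => // n b bB.
by rewrite -dotp_adjoint mulmxA; have := xG n.+1 b bB; rewrite exprS.
Qed.

Lemma integer_vectors_dual_Gamma (R0 : 'M[int]_d) B : 0 \in B ->
  [set` B] `<=` integer_vectors ->
  integer_vectors `<=` dual_group (Gamma (map_mx intr R0 : 'M[K]_d) B).
Proof.
move=> B0 Bint x xint; apply/dual_GammaP => // n b /Bint bint.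
have Rb i : (map_mx intr R0 ^+ n *m b : 'cV[K]_d) i 0 \is a Num.int.
  elim: n i => [|n IHn] i; first by rewrite expr0 mul1mx.
  rewrite exprS -mulmxA mxE rpred_sum// => j _.
  by rewrite rpredM// mxE intr_int.
by rewrite rpred_sum// => i _; rewrite rpredM.
Qed.

(** R^-1 b . R^T x = b . x is an integer, so l and l' give equal columns of the
    Hadamard matrix; an invertible matrix has no repeated column. *)
Lemma hadamard_digit_unique R B L l l' x : R \in unitmx -> 0 \in B ->
  hadamard_triple R B L -> l \in L -> l' \in L ->
  (forall b, b \in B -> dotp b x \is a Num.int) -> l - l' = R^T *m x -> l = l'.
Proof.
move=> Ru B0 [cardLB]; set H := \matrix_(i, j) _ => Hu lL l'L xint ll'.
have N0 : (#|` B|%:R : K) != 0.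
  by rewrite pnatr_eq0 cardfs_eq0; apply/fset0Pn; exists 0.
have ltj c (cL : c \in L) : (index c L < #|` B|)%N by rewrite -cardLB index_mem.
pose j := Ordinal (ltj _ lL); pose j' := Ordinal (ltj _ l'L).
have Hjj' i : H i j = H i j'.
  rewrite !mxE /= !nth_index//; congr (_ * _).
  have -> : l = l' + R^T *m x by rewrite -ll' addrC subrK.
  rewrite dotpDr expi2piD -dotp_adjoint mulKVmx//.
  by rewrite [X in _ * X]expi2pi_int ?mulr1// xint// mem_nth.
have [/eqP|nejj'] := eqVneq j j'.
  by rewrite -val_eqE /= => /eqP/(congr1 (nth 0 L)); rewrite !nth_index.
have : invmx H *m col j H = invmx H *m col j' H.
  by congr (_ *m _); apply/colP => i; have := Hjj' i; rewrite !mxE.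
rewrite !colE !mulKmx ?unitarymx_unit// => /matrixP/(_ j 0)/eqP.
by rewrite !mxE !eqxx (negbTE nejj') oner_eq0.
Qed.

(** Two points of the dual group pair with each v_i to numbers that differ by an
    integer, and this difference is less than 1 if both points are near x; so it
    vanishes, and the v_i span the space.  As
    x need not belong to the dual group, this excludes accumulation points
    anywhere, which is more than discreteness. *)
Lemma dual_group_separated (G : set 'cV[K]_d) (v : d.-tuple 'cV[K]_d) x :
  (forall i, G (tnth v i)) -> free v ->
  exists2 U, nbhs x U & forall y z, dual_group G y -> dual_group G z ->
    U y -> U z -> y = z.
Proof.
move=> vG vfree.
exists [set y | forall i, `|dotp (tnth v i) x - dotp (tnth v i) y| < 2^-1].
  apply: (@filter_forall _ _ _ (nbhs x)) => i.
  have /cvgrPdist_lt : dotp (tnth v i) @ x --> dotp (tnth v i) x.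
    exact: dotp_continuous.
  by apply; rewrite invr_gt0.
move=> y z yG zG Uy Uz; apply/eqP; rewrite -subr_eq0; apply/eqP.
have v0 i : dotp (tnth v i) (y - z) = 0.
  apply/eqP; have : dotp (tnth v i) (y - z) \is a Num.int.
    by rewrite dotpDr dotpNr rpredB ?yG ?zG.
  move=> /norm_intr_ge1; case: eqP => // _ /(_ isT); rewrite leNgt => /negP[].
  have := Uy i; have := Uz i; rewrite !ltr_norml dotpDr dotpNr.
  by move=> /andP[? ?] /andP[? ?]; apply/andP; split; lra.
have vbasis : <<v>>%VS = fullv.
  apply/eqP; rewrite eqEdim subvf dimvf /dim /= (eqP vfree) size_tuple.
  by rewrite muln1.
apply/colP => i; rewrite [RHS]mxE -[LHS]dotp_delta.
have /coord_span -> : delta_mx i 0 \in <<v>>%VS by rewrite vbasis memvf.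
rewrite dotp_suml big1// => j _.
by rewrite dotpZl -tnth_nth v0 mulr0.
Qed.

Lemma span_delta :
  span [seq (delta_mx i 0 : 'cV[K]_d) | i <- enum 'I_d] = fullv.
Proof.
apply/eqP; rewrite eqEsubv subvf /=; apply/subvP => x _.
have -> : x = \sum_i x i 0 *: delta_mx i 0.
  by rewrite {1}[x]matrix_sum_delta; apply: eq_bigr => i _; rewrite big_ord1.
apply: rpred_sum => i _; apply/rpredZ/memv_span/map_f.
by rewrite mem_enum.
Qed.

End Dual.

(** * Powers of matrices of spectral radius less than 1 *)

Section Powers.
Context {K : realType}.
Local Notation C := K[i]%C.
Local Notation normc := (@Normc.normc K).

(** Once w is below (1 - r) e / 2, the recursion preserves the bound e / 2, and
    what exceeds it decays geometrically. *)
Lemma contraction_perturbed_cvg0 (r : K) (a w : nat -> K) : 0 <= r < 1 ->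
  (forall n, 0 <= a n) -> (forall n, a n.+1 <= r * a n + w n) ->
  w @ \oo --> (0 : K) -> a @ \oo --> (0 : K).
Proof.
move=> /andP[r0 r1] a0 aS w0; apply/cvgr0Pnorm_le => e e0.
have [N _ wN] : \forall n \near \oo, `|w n| <= (1 - r) * (e / 2).
  by apply: (cvgr0Pnorm_le _).1 => //; rewrite mulr_gt0 ?divr_gt0 ?subr_gt0.
have aN k : a (k + N)%N <= r ^+ k * a N + e / 2.
  elim: k => [|k IHk]; first by rewrite expr0 mul1r lerDl ltW ?divr_gt0.
  rewrite addSn; apply: le_trans (aS _) _.
  have := le_trans (ler_norm _) (wN (k + N)%N (leq_addl _ _)).
  have := ler_wpM2l r0 IHk; rewrite mulrDr mulrA -exprS => *.
  by lra.
have ra0 : r ^+ k * a N @[k --> \oo] --> (0 : K).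
  rewrite -[X in _ --> X](mul0r (a N)); apply: cvgMr_tmp.
  by apply: cvg_expr; rewrite ger0_norm.
have [M _ rM] : \forall k \near \oo, `|r ^+ k * a N| <= e / 2.
  by apply: (cvgr0Pnorm_le _).1 => //; rewrite divr_gt0.
exists (M + N)%N => // n /= Mn; rewrite ger0_norm//.
have Nn : (N <= n)%N := leq_trans (leq_addl M N) Mn.
have MnN : (M <= n - N)%N by rewrite leq_subRL// addnC.
have := aN (n - N)%N; rewrite subnK// => aE.
by have := le_trans (ler_norm _) (rM (n - N)%N MnN) => ?; lra.
Qed.

(** By Cayley-Hamilton, A^k times the product of all factors A - z vanishes.
    The factors are removed one at a time: if A^k (A - z) P tends to 0
    entrywise, then A^k P satisfies A^(k+1) P = z (A^k P) + o(1) with |z| < 1,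
    and therefore tends to 0 too. *)
Lemma spectral_contraction_powers n (A : 'M[C]_n) :
  (forall z, eigenvalue A z -> `|z| < 1) ->
  forall i j, normc ((A ^+ k) i j) @[k --> \oo] --> (0 : K).
Proof.
case: n A => [A _ []//|n A Aspec].
have [r charE] := closed_field_poly_normal (char_poly A).
have rlt1 z : z \in r -> normc z < 1.
  move=> zr; rewrite -ltcR; apply: Aspec; rewrite eigenvalue_root_char charE.
  rewrite (monicP (char_poly_monic A)) scale1r.
  by rewrite root_prod_XsubC.
have Ar : horner_mx A (\prod_(z <- r) ('X - z%:P)) = 0.
  have := Cayley_Hamilton A.
  by rewrite charE (monicP (char_poly_monic A)) scale1r.
have : forall i j,
    normc ((A ^+ k * horner_mx A (\prod_(z <- r) ('X - z%:P))) i j)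
      @[k --> \oo] --> (0 : K).
  move=> i j; under eq_cvg do rewrite Ar mulr0 mxE Normc.normc0.
  exact: cvg_cst.
elim: r rlt1 {charE Ar} => [_|z r IHr rlt1].
  rewrite big_nil rmorph1 => A0 i j; have := A0 i j.
  by under eq_cvg do rewrite mulr1.
rewrite big_cons rmorphM rmorphB /= horner_mx_X horner_mx_C => zr0.
apply: IHr => [y yr|i j]; first by rewrite rlt1 ?inE ?yr ?orbT.
set P := horner_mx A _ in zr0 *.
apply: (@contraction_perturbed_cvg0 (normc z) _ _ _ _ _ (zr0 i j)) => [|k|k].
- rewrite rlt1 ?inE ?eqxx// andbT.
  by case: z {rlt1 zr0} => x y; exact: sqrtr_ge0.
- by case: (_ i j) => x y; exact: sqrtr_ge0.
have -> : A ^+ k.+1 * P = z *: (A ^+ k * P) + A ^+ k * ((A - z%:M) * P).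
  have -> : z *: (A ^+ k * P) = A ^+ k * (z%:M * P).
    by rewrite -!mulmxE mul_scalar_mx scalemxAr.
  by rewrite mulrBl mulrBr exprSr -mulrA addrC subrK.
by rewrite mxE; apply: le_trans (le_normcD _ _) _; rewrite mxE Normc.normcM.
Qed.

Lemma expansive_unitmx d (R : 'M[K]_d) : expansive R -> R \in unitmx.
Proof.
move=> Rexp; rewrite -(map_unitmx (real_complex K)); apply: contraT => nu.
have := Rexp 0; rewrite normr0 ltr10 => H; apply: H.
by rewrite /eigenvalue /eigenspace kermx_eq0 raddf0 subr0 row_free_unit.
Qed.

Lemma expansive_inv_powers d (R : 'M[K]_d) : expansive R ->
  forall i j, (invmx R ^+ k) i j @[k --> \oo] --> (0 : K).
Proof.
move=> Rexp i j; have Ru := expansive_unitmx _ _ Rexp.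
have : normc ((map_mx (real_complex K) (invmx R) ^+ k) i j) @[k --> \oo]
    --> (0 : K).
  apply: spectral_contraction_powers => z /eigenvalueP[v vz v0].
  move: vz; rewrite map_invmx; set Rc := map_mx _ R => vz.
  have Rcu : Rc \in unitmx by rewrite map_unitmx.
  have vE : v = z *: (v *m Rc) by rewrite scalemxAl -vz mulmxKV.
  have z0 : z != 0 by apply: contraNneq v0 => z0; rewrite vE z0 scale0r.
  have : 1 < `|z^-1|.
    apply: Rexp; apply/eigenvalueP; exists v => //.
    by rewrite [in RHS]vE scalerA mulVf// scale1r.
  by rewrite normfV invf_gt1// normr_gt0.
move=> Rk0; apply: norm_cvg0; apply: cvg_trans Rk0.
apply: near_eq_cvg; apply: nearW => k.
have -> : map_mx (real_complex K) (invmx R) ^+ k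
    = map_mx (real_complex K) (invmx R ^+ k).
  by elim: k => [|k IHk]; rewrite ?map_mx1// !exprS map_mxM IHk.
by rewrite mxE /= expr0n /= addr0 sqrtr_sqr.
Qed.

Lemma expansive_trmx_iter_cvg0 d (R : 'M[K]_d) (v : 'cV[K]_d) : expansive R ->
  invmx R^T ^+ k *m v @[k --> \oo] --> (0 : 'cV[K]_d).
Proof.
move=> Rexp U [P P0 sPU].
suff : \forall k \near \oo, forall i j, P i j ((invmx R^T ^+ k *m v) i j).
  by apply: filterS => k; exact: sPU.
apply: filter_forall => i; apply: filter_forall => j.
suff : (invmx R^T ^+ k *m v) i j @[k --> \oo] --> (0 : K).
  by apply; have := P0 i j; rewrite mxE.
have kT k : invmx R^T ^+ k = (invmx R ^+ k)^T.
  rewrite -trmx_inv; elim: k => [|k IHk]; first by rewrite trmx1.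
  by rewrite exprS exprSr IHk trmx_mul.
under eq_cvg do rewrite mxE.
suff : \sum_l (invmx R^T ^+ k) i l * v l j @[k --> \oo]
    --> \sum_(l < d) (0 : K).
  by rewrite big1.
apply: cvg_big => [|l _]; first exact: add_continuous.
rewrite -(mul0r (v l j)); apply: cvgMr_tmp.
under eq_cvg do rewrite kT mxE.
exact: expansive_inv_powers.
Qed.

End Powers.

(** * Cycles and the attractor *)

Section Attractor.
Context {K : realType} {d : nat}.
Implicit Types (S : 'M[K]_d) (L : {fset 'cV[K]_d}) (X : set 'cV[K]_d).

Lemma attractor_tau S L X l x : is_attractor S L X -> l \in L -> X x ->
  X (tau S l x).
Proof. by move=> [_ _ XE] lL Xx; rewrite XE; exists l => //; exists x. Qed.

(** Applying the maps tau_l of the cycle in turn, p at a time and from any y in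
    X, gives points of X that converge to x_0. *)
Lemma attractor_cycle S L X C :
  (forall v, invmx S ^+ k *m v @[k --> \oo] --> (0 : 'cV[K]_d)) ->
  is_attractor S L X -> is_cycle S L C -> C `<=` X.
Proof.
move=> S0 Xattr [p [l [x [p0 xS xp ->]]]].
have [[y Xy] Xcpt _] := Xattr.
have step z k : X z -> (k <= p)%N ->
    exists2 z', X z' & z' - x k = invmx S ^+ k *m (z - x 0%N).
  move=> Xz; elim: k => [|k IHk] kp.
    by exists z => //; rewrite expr0 mul1mx.
  have [z' Xz' z'E] := IHk (ltnW kp); have [lL ->] := xS _ kp.
  exists (tau S (l k) z'); first exact: (attractor_tau _ L).
  by rewrite /tau -mulmxBr opprD addrACA subrr addr0 z'E mulmxA exprS.
have orbit n : X (x 0%N + invmx S ^+ (p * n) *m (y - x 0%N)).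
  elim: n => [|n IHn]; first by rewrite muln0 expr0 mul1mx addrC subrK.
  have [z Xz] := step _ _ IHn (leqnn p).
  rewrite xp [_ + _ - x 0%N in RHS]addrAC subrr add0r mulmxA => /eqP.
  by rewrite subr_eq mulnS exprD addrC => /eqP <-.
have X0 : X (x 0%N).
  apply: (compact_closed (@norm_hausdorff K 'cV[K]_d) Xcpt) => U xU.
  have : x 0%N + invmx S ^+ k *m (y - x 0%N) @[k --> \oo] --> x 0%N.
    rewrite -[X in _ --> X]addr0; apply: cvgD; first exact: cvg_cst.
    exact: S0.
  move=> /(_ _ xU)[N _ UN]; exists (x 0%N + invmx S ^+ (p * N) *m (y - x 0%N)).
  by split; [exact: orbit|apply: UN; rewrite /= leq_pmull].
move=> _ [k /= kp <-]; elim: k kp => // k IHk kp.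
have [lL ->] := xS _ (ltnW kp).
by apply: (attractor_tau _ L) => //; exact/IHk/ltnW.
Qed.

End Attractor.

(** The orbit of x accumulates at some q by compactness.  Near q there is at
    most one point of F, so the orbit takes some value at two distinct times,
    and injectivity cancels the steps up to the earlier one. *)
Lemma injective_orbit_periodic (T : topologicalType) (X F : set T)
    (g : T -> T) :
  compact X -> F `<=` X ->
  (forall x : T, exists2 U : set T, nbhs x U &
    forall y z, F y -> F z -> U y -> U z -> y = z) ->
  (forall x, F x -> F (g x)) ->
  (forall x y, F x -> F y -> g x = g y -> x = y) ->
  forall x, F x -> exists2 n, (0 < n)%N & iter n g x = x.
Proof.
move=> Xcpt FX Fsep gF ginj x Fx.
have itF n : F (iter n g x) by elim: n => //= n; exact: gF.
have [|q [_ qcl]] := Xcpt (iter n g x @[n --> \oo]) (fmap_proper_filter _ _).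
  by exists 0%N => // n _; apply/FX/itF.
have [U qU Usep] := Fsep q.
have often N : exists2 n, (N <= n)%N & U (iter n g x).
  pose tail := [set iter n g x | n in [set n | (N <= n)%N]].
  have [|_ [[n /= Nn <-] Un]] := qcl tail U _ qU.
    by exists N => // n /= Nn; exists n.
  by exists n.
have [m _ Um] := often 0%N; have [n mn Un] := often m.+1.
exists (n - m)%N; first by rewrite subn_gt0.
have := Usep _ _ (itF m) (itF n) Um Un.
rewrite -{1}(subnKC (ltnW mn)) iterD.
have : F (iter (n - m) g x) by exact: itF.
move: (iter _ g x) => y Fy; elim: m {Um mn} => [|m IHm] //= eq_g.
apply: IHm; apply: ginj => //; elim: m {eq_g} => //= m; exact: gF.
Qed.

(** * Points of the dual group in the attractor *)

Section Cycles.
Context {K : realType} {d : nat}.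
Implicit Types (R S : 'M[K]_d) (B L : {fset 'cV[K]_d}) (C X : set 'cV[K]_d).

Lemma mul_tau S l x : S \in unitmx -> S *m tau S l x = x + l.
Proof. by move=> Su; rewrite mulKVmx. Qed.

Lemma is_cycle_pred S L C x : is_cycle S L C -> C x ->
  exists l z, [/\ l \in L, C z & x = tau S l z].
Proof.
move=> [p [l [u [p0 uS up ->]]]] [[|k] /= kp <-].
  (* The point x_0 is x_p, so its predecessor is x_(p-1). *)
  have p1p : (p.-1 < p)%N by rewrite prednK.
  have [lL uE] := uS _ p1p.
  exists (l p.-1), (u p.-1); split=> //; first by exists p.-1.
  by rewrite -up -uE prednK.
have [lL uE] := uS k (ltnW kp).
by exists (l k), (u k); split=> //; exists k => //=; exact: ltnW.
Qed.

(** Induction on n in R^n b . x: if x = tau_l z then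
    R^(n+1) b . x = R^n b . S x = R^n b . z + R^n b . l. *)
Lemma WB_cycle_sub_dual R B L C : R \in unitmx -> 0 \in B ->
  [set` L] `<=` dual_group (Gamma R B) -> is_WB_cycle R^T B L C ->
  C `<=` dual_group (Gamma R B).
Proof.
move=> Ru B0 LG [Ccyc W1] x Cx; apply/dual_GammaP => // n.
elim: n x Cx => [|n IHn] x Cx b bB.
  by rewrite expr0 mul1mx; apply: (W_B_eq1P _ _ B0).1 b bB; exact: W1.
have [l [z [lL Cz ->]]] := is_cycle_pred _ _ _ _ Ccyc Cx.
rewrite exprS -mulmxA dotp_adjoint mul_tau ?unitmx_tr// dotpDr.
by rewrite rpredD ?(IHn z)//; exact: ((dual_GammaP _ _ _ B0).1 (LG _ lL)).
Qed.

(** Choose for every point y of the dual group in X a predecessor y' in X and a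
    digit leading from y' to y.  The choice of y' is injective by uniqueness of
    digits, so the orbit of x under y |-> y' returns to x; read in the opposite
    order, it is the cycle through x. *)
Lemma dual_attractor_cycle R B L X (v : d.-tuple 'cV[K]_d) x :
  R \in unitmx -> 0 \in B -> hadamard_triple R B L ->
  [set` L] `<=` dual_group (Gamma R B) -> is_attractor R^T L X ->
  (forall i, Gamma R B (tnth v i)) -> free v ->
  dual_group (Gamma R B) x -> X x ->
  exists2 C, is_WB_cycle R^T B L C & C x.
Proof.
move=> Ru B0 had LG Xattr vG vfree; set G := dual_group _ in LG *.
have Su : R^T \in unitmx by rewrite unitmx_tr.
have [_ Xcpt XE] := Xattr; have [G0 GB] : additive_subgroup G.
  exact: dual_group_additive.
pose F := G `&` X.
have /choice[g gP] (y : 'cV[K]_d) : exists zl : 'cV[K]_d * 'cV[K]_d,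
    F y -> [/\ F zl.1, zl.2 \in L & y = tau R^T zl.2 zl.1].
  have [[Gy Xy]|nFy] := pselect (F y); last by exists (0, 0).
  move: (Xy); rewrite {1}XE => -[l lL [z Xz zy]]; exists (z, l) => _.
  split=> //; split=> //=; have -> : z = R^T *m y - l.
    by rewrite -zy mul_tau// addrK.
  by apply: GB; [exact: dual_Gamma_trmx|exact: LG].
have gF y : F y -> F (g y).1 by move=> /gP[].
have ginj y z : F y -> F z -> (g y).1 = (g z).1 -> y = z.
  move=> Fy Fz gyz; have [_ lyL yE] := gP _ Fy; have [_ lzL zE] := gP _ Fz.
  rewrite yE zE gyz; congr tau.
  apply: (hadamard_digit_unique R B L _ _ (y - z) Ru B0 had lyL lzL).
    move=> b bB; have := GB _ _ Fy.1 Fz.1.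
    by move=> /(dual_GammaP _ _ _ B0)/(_ 0%N b bB); rewrite mul1mx.
  by rewrite mulmxBr {2}yE {2}zE !mul_tau// gyz opprD addrACA subrr add0r.
move=> Gx Xx; have Fx : F x by [].
have [n n0 nx] : exists2 n, (0 < n)%N & iter n (fst \o g) x = x.
  apply: (injective_orbit_periodic _ _ F _ Xcpt _ _ gF ginj) => //.
    by move=> y [].
  move=> y; have [U yU Usep] := dual_group_separated _ _ y vG vfree.
  by exists U => // s t [Gs _] [Gt _]; exact: Usep.
have Fit m : F (iter m (fst \o g) x) by elim: m => //= m; exact: gF.
exists [set iter (n - k) (fst \o g) x | k in `I_n]; last first.
  by exists 0%N => //=; rewrite subn0.
split.
  exists n, (fun k => (g (iter (n - k.+1) (fst \o g) x)).2).
  exists (fun k => iter (n - k) (fst \o g) x); split=> //.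
    move=> k kn; have [_ lL] := gP _ (Fit (n - k.+1)%N).
    by rewrite -(subnSK kn).
  by rewrite subnn subn0 nx.
move=> _ [k _ <-]; apply/W_B_eq1P => // b bB.
have [/(dual_GammaP _ _ _ B0)/(_ 0%N b bB)] := Fit (n - k)%N.
by rewrite mul1mx.
Qed.

End Cycles.

Theorem theorem4p1 (K : realType) (d : nat) (R0 : 'M[int]_d)
    (R := map_mx intr R0 : 'M[K]_d) (S := R^T)
    (B L : {fset 'cV[K]_d}) (XL : set 'cV[K]_d)
    (hexp : expansive R)
    (hHad : hadamard_triple R B L)
    (hBint : [set` B] `<=` integer_vectors)
    (hB0 : 0 \in B)
    (hRBL : forall (n : nat) (b l : 'cV[K]_d), b \in B -> l \in L ->
       dotp (R ^+ n *m b) l \is a Num.int)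
    (hXL : is_attractor S L XL)
    (hindep : exists v : d.-tuple 'cV[K]_d,
       (forall i, Gamma R B (tnth v i)) /\ free v) :
  let Gamma_dual := dual_group (Gamma R B) in
  [/\ is_lattice Gamma_dual,
      integer_vectors `<=` Gamma_dual,
      [set S *m x | x in Gamma_dual] `<=` Gamma_dual,
      forall l l' : 'cV[K]_d, l \in L -> l' \in L ->
        [set S *m x | x in Gamma_dual] (l - l') -> l = l'
    & Gamma_dual `&` XL = \bigcup_(C in [set C | is_WB_cycle S B L C]) C].
Proof.
move=> G; have [v [vG vfree]] := hindep.
have Ru : R \in unitmx by exact: expansive_unitmx.
have intG : integer_vectors `<=` G by exact: integer_vectors_dual_Gamma.
have LG : [set` L] `<=` G.
  by move=> l lL; apply/dual_GammaP => // n b bB; exact: hRBL.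
split=> //.
- split; first exact: dual_group_additive.
    move=> x Gx; split; first exact/mem_set.
    have [U xU Usep] := dual_group_separated _ _ x vG vfree.
    exists U => //; apply/seteqP; split=> [y [Uy Gy]|_ ->] /=.
      by apply: Usep => //; exact: nbhs_singleton.
    by split=> //; exact: nbhs_singleton.
  exists [seq delta_mx i 0 | i <- enum 'I_d]; split; last exact: span_delta.
  move=> _ /mapP[i _ ->]; apply: intG => j.
  by rewrite mxE rpred_nat.
- by move=> _ [x Gx <-]; exact: dual_Gamma_trmx.
- move=> l l' lL l'L [x Gx Sx].
  apply: (hadamard_digit_unique R B L _ _ x Ru hB0 hHad) => // b bB.
  by move: Gx => /(dual_GammaP _ _ _ hB0)/(_ 0%N b bB); rewrite mul1mx.
apply/seteqP; split=> [x [Gx Xx]|x [C Ccyc Cx]].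
  have [C Ccyc Cx] : exists2 C, is_WB_cycle S B L C & C x.
    exact: (dual_attractor_cycle R B L XL v).
  by exists C.
split; first exact: (WB_cycle_sub_dual R B L C).
apply: (attractor_cycle S L XL C) Cx => //; last by case: Ccyc.
by move=> w; exact: expansive_trmx_iter_cvg0.
Qed.
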